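(* Let $\Omega$ be a set and $G\in(\mathbb{R}\to\mathbb{R})^\Omega$, and let $\mathcal{A}_\Omega$ be the space of formal Chen integrals over $\Omega$ (with $G$ fixed). With the operations $\prec$ and $\succ$ given by sums over shuffles, $(\mathcal{A}_\Omega,\prec,\succ)$ is an (augmented) dendriform algebra.
   Context: $\mathbb{K}$ is the ground field. **Dendriform algebras.** A dendriform algebra is a vector space $A$ with bilinear operations $\prec,\succ$ such that, with $x\star y:=x\prec y+x\succ y$, for all $x,y,z\in A$: $(x\prec y)\prec z=x\prec(y\star z)$; $(x\succ y)\prec z=x\succ(y\prec z)$; $(x\star y)\succ z=x\succ(y\succ z)$. The augmented dendriform algebra is $\overline A=A\oplus\mathbb{K}1$ with $1\prec a=0=a\succ1$, $a\prec1=a=1\succ a$ for $a\in A$ ($1\prec 1$ and $1\succ 1$ undefined, $1\star1=1$). ''Dendriform algebra'' always means the augmented one. **Formal integrals.** For $n\in\mathbb{N}$, let $\mathrm{B}_{\mathrm{int}}(\mathbb{R}^n)$ be the set of Borel subsets of $\mathbb{R}^n$ modulo Lebesgue-negligible Borel sets, $\mathbb{K}\mathrm{B}_{\mathrm{int}}(\mathbb{R}^n)$ the vector space with this basis, an algebra for the bilinear extension of $\cup$, and $\mathfrak{B}(\mathbb{R}^n)$ its quotient by the ideal generated by the elements $A\cup B-A-B+A\cap B$, $A,B\in\mathrm{B}_{\mathrm{int}}(\mathbb{R}^n)$. Write $g_\omega:=G(\omega)$. A formal integral is a pair $(B\otimes w,G)$ in $\langle\mathfrak{B}(\mathbb{R}^{\ell(w)})\otimes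 w\mid w\text{ a finite word on }\Omega\rangle\times(\mathbb{R}\to\mathbb{R})^\Omega$, where $\ell$ is the length; for $w=w_1\cdots w_k$ it is also written $B\otimes w\times G$ or $\int_B\big(\prod_{i=1}^k g_{w_i}\big)\mathrm{d}t_1\cdots\mathrm{d}t_k$. It is a purely formal object. With $G$ fixed, vector space operations are those of the first factor. **Formal Chen integrals.** $\mathcal{A}_\Omega$ is the span of all $\int_{0<t_1<\dots<t_r<1}\big(\prod_{i=1}^r g_{\omega_i}\big)\prod_{i=1}^r\mathrm{d}t_i$, $r\ge0$, $\omega_1\cdots\omega_r$ a word on $\Omega$; the element for $r=0$, $\emptyset\otimes\emptyset\times G$, is the unit. **Operations.** For $k,l\ge1$, $\mathrm{Sh}(k,l)$ is the set of permutations $\sigma\in S_{k+l}$ with $\sigma(1)<\dots<\sigma(k)$ and $\sigma(k+1)<\dots<\sigma(k+l)$. For $\alpha=\int_{0<t_1<\dots<t_k<1}\prod_{i=1}^k g_{\omega_i}\mathrm{d}t_i$ and $\beta=\int_{0<t_{k+1}<\dots<t_{k+l}<1}\prod_{i=k+1}^{k+l}g_{\omega_i}\mathrm{d}t_i$ ($k,l\ge1$), $$\alpha\prec\beta=\sum_{\sigma\in\mathrm{Sh}(k,l),\ \sigma^{-1}(1)=1}\ \int_{0<t_1<\dots<t_{k+l}<1}\prod_{i=1}^{k+l}g_{\omega_{\sigma^{-1}(i)}}\mathrm{d}t_i,\qquad \alpha\succ\beta=\sum_{\sigma\in\mathrm{Sh}(k,l),\ \sigma^{-1}(1)=k+1}\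 \int_{0<t_1<\dots<t_{k+l}<1}\prod_{i=1}^{k+l}g_{\omega_{\sigma^{-1}(i)}}\mathrm{d}t_i,$$ extended bilinearly, and to the unit as in an augmented dendriform algebra. *)

(* Defs.v *)
From HB Require Import structures.
From mathcomp Require Import all_boot all_order all_algebra.
From mathcomp Require Import generic_quotient ring_quotient perm.
From mathcomp Require Import finmap monalg.
From mathcomp Require Import all_classical all_reals all_analysis.

Set Implicit Arguments.
Unset Strict Implicit.
Unset Printing Implicit Defensive.

Import Order.TTheory GRing.Theory Num.Theory.

Local Open Scope classical_set_scope.
Local Open Scope ring_scope.
Local Open Scope quotient_scope.

Section GeneratedIdeal.
Variables (A : comNzRingType) (I : Type) (g : I -> A).

Definition gen_ideal : {pred A} :=
  fun p => `[< exists s : seq (A * I), p = \sum_(c <- s) c.1 * g c.2 >].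

Lemma gen_ideal_closed : 1 \notin gen_ideal -> idealr_closed gen_ideal.
Proof.
split=> //; first by apply/asboolP; exists [::]; rewrite big_nil.
move=> a _ _ /asboolP[s ->] /asboolP[t ->]; apply/asboolP.
exists ([seq (a * c.1, c.2) | c <- s] ++ t).
rewrite big_cat big_map mulr_sumr; congr (_ + _).
by apply: eq_bigr => c _; rewrite mulrA.
Qed.

Lemma gen_ideal_kernel (S : comNzRingType) (f : {rmorphism A -> S}) p :
  (forall i, f (g i) = 0) -> p \in gen_ideal -> f p = 0.
Proof.
move=> fg0 /asboolP[s ->]; rewrite rmorph_sum big1 // => c _.
by rewrite rmorphM fg0 mulr0.
Qed.
End GeneratedIdeal.

(* The quotient of a commutative algebra by an ideal, as a vector space; the
   library only provides its ring structure. *)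
Section AlgebraQuotient.
Variables (K : fieldType) (A : comAlgType K) (I : idealr A).

Definition alg_quot := {ideal_quot I}.
HB.instance Definition _ := GRing.ComNzRing.on alg_quot.
HB.instance Definition _ := EqQuotient.on alg_quot.

Definition alg_quot_pi (p : A) : alg_quot := \pi_alg_quot p.
Definition alg_quot_scale (a : K) (x : alg_quot) : alg_quot :=
  alg_quot_pi (a *: repr x).

Lemma alg_quot_piP p q : alg_quot_pi p = alg_quot_pi q <-> p - q \in I.
Proof. by rewrite (rwP eqP) /alg_quot_pi Quotient.idealrBE. Qed.

Lemma alg_quot_reprK x : alg_quot_pi (repr x) = x.
Proof. exact: reprK. Qed.

Lemma alg_quot_ind (P : alg_quot -> Prop) :
  (forall p, P (alg_quot_pi p)) -> forall x, P x.
Proof. by move=> Ppi x; rewrite -(alg_quot_reprK x). Qed.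

Lemma alg_quot_piD : {morph alg_quot_pi : p q / p + q}.
Proof. by move=> p q; rewrite /alg_quot_pi !piE. Qed.

Lemma alg_quot_piZ a p : alg_quot_scale a (alg_quot_pi p) = alg_quot_pi (a *: p).
Proof.
apply/alg_quot_piP; rewrite -scalerBr -mulr_algl; apply: idealMr.
by apply/alg_quot_piP; exact: alg_quot_reprK.
Qed.

Let scaleA a b x :
  alg_quot_scale a (alg_quot_scale b x) = alg_quot_scale (a * b) x.
Proof. by elim/alg_quot_ind: x => p; rewrite !alg_quot_piZ scalerA. Qed.
Let scale1 : left_id 1 alg_quot_scale.
Proof. by elim/alg_quot_ind => p; rewrite alg_quot_piZ scale1r. Qed.
Let scaleDr : right_distributive alg_quot_scale +%R.
Proof.
move=> a; elim/alg_quot_ind => p; elim/alg_quot_ind => q.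
by rewrite -alg_quot_piD !alg_quot_piZ scalerDr alg_quot_piD.
Qed.
Let scaleDl x : {morph alg_quot_scale^~ x : a b / a + b}.
Proof.
move=> a b; elim/alg_quot_ind: x => p.
by rewrite !alg_quot_piZ scalerDl alg_quot_piD.
Qed.
HB.instance Definition _ := GRing.Zmodule_isLmodule.Build K alg_quot
  scaleA scale1 scaleDr scaleDl.

Lemma alg_quot_pi_linear : linear alg_quot_pi.
Proof. by move=> a p q; rewrite alg_quot_piD -alg_quot_piZ. Qed.
HB.instance Definition _ :=
  GRing.isLinear.Build K A alg_quot *:%R alg_quot_pi alg_quot_pi_linear.

Section Lift.
Variable f : {scalar A}.

Definition alg_quot_lift (x : alg_quot) : K := f (repr x).

Hypothesis f0 : forall p, p \in I -> f p = 0.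

Lemma alg_quot_lift_pi p : alg_quot_lift (alg_quot_pi p) = f p.
Proof.
apply/eqP; rewrite -subr_eq0 -linearB; apply/eqP/f0/alg_quot_piP.
exact: alg_quot_reprK.
Qed.

Lemma alg_quot_lift_linear : scalar alg_quot_lift.
Proof.
move=> a; elim/alg_quot_ind => p; elim/alg_quot_ind => q.
by rewrite -alg_quot_pi_linear !alg_quot_lift_pi linearP.
Qed.
End Lift.
End AlgebraQuotient.

Section DirectSum.
Variables (K : fieldType) (I : choiceType) (V : I -> lmodType K).

Definition fin_supp : {pred forall i, V i} :=
  fun f => `[< finite_set [set i | f i != 0] >].

Definition dsum := {f : forall i, V i | fin_supp f}.
HB.instance Definition _ := Choice.on dsum.

Definition dsum_mk (f : forall i, V i) (fS : fin_supp f) : dsum :=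
  exist _ f fS.
Definition dsum_fun (x : dsum) : forall i, V i := val x.

Lemma dsumP (x y : dsum) : (forall i, dsum_fun x i = dsum_fun y i) -> x = y.
Proof. by move=> xy; apply/val_inj/functional_extensionality_dep. Qed.

Lemma dsum_finite (x : dsum) : finite_set [set i | dsum_fun x i != 0].
Proof. exact/asboolP/(valP x). Qed.

Let fin_supp0 : fin_supp (fun=> 0).
Proof.
by apply/asboolP; apply: sub_finite_set (finite_set0 I) => i /=; rewrite eqxx.
Qed.
Let fin_suppN x : fin_supp (fun i => - dsum_fun x i).
Proof.
apply/asboolP; apply: sub_finite_set (dsum_finite x) => i /=.
by rewrite oppr_eq0.
Qed.
Let fin_suppD x y : fin_supp (fun i => dsum_fun x i + dsum_fun y i).
Proof.
apply/asboolP.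
have fU : finite_set
    ([set i | dsum_fun x i != 0] `|` [set i | dsum_fun y i != 0]).
  by rewrite finite_setU; split; exact: dsum_finite.
apply: sub_finite_set fU => i /= xy0.
have [x0|] := eqVneq (dsum_fun x i) 0; last by left.
by right; rewrite x0 add0r in xy0.
Qed.
Let fin_suppZ (a : K) x : fin_supp (fun i => a *: dsum_fun x i).
Proof.
apply/asboolP; apply: sub_finite_set (dsum_finite x) => i /=.
by apply: contraNN => /eqP ->; rewrite scaler0.
Qed.
Let fin_supp_single i (v : V i) : fin_supp (@dfwith I V (fun=> 0) i v).
Proof.
apply/asboolP; apply: sub_finite_set (finite_set1 i) => j /=.
by case: dfwithP => // k ik; rewrite eqxx.
Qed.

Definition dsum0 : dsum := dsum_mk fin_supp0.
Definition dsumN x : dsum := dsum_mk (fin_suppN x).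
Definition dsumD x y : dsum := dsum_mk (fin_suppD x y).
Definition dsumZ a x : dsum := dsum_mk (fin_suppZ a x).
Definition dsum_single i (v : V i) : dsum := dsum_mk (fin_supp_single v).

Let dsumA : associative dsumD.
Proof. by move=> x y z; apply: dsumP => i; exact: addrA. Qed.
Let dsumC : commutative dsumD.
Proof. by move=> x y; apply: dsumP => i; exact: addrC. Qed.
Let dsum0D : left_id dsum0 dsumD.
Proof. by move=> x; apply: dsumP => i; exact: add0r. Qed.
Let dsumND : left_inverse dsum0 dsumN dsumD.
Proof. by move=> x; apply: dsumP => i; exact: addNr. Qed.
HB.instance Definition _ := GRing.isZmodule.Build dsum dsumA dsumC dsum0D dsumND.

Let dsumZA a b x : dsumZ a (dsumZ b x) = dsumZ (a * b) x.
Proof. by apply: dsumP => i; exact: scalerA. Qed.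
Let dsumZ1 : left_id 1 dsumZ.
Proof. by move=> x; apply: dsumP => i; exact: scale1r. Qed.
Let dsumZDr : right_distributive dsumZ +%R.
Proof. by move=> a x y; apply: dsumP => i; exact: scalerDr. Qed.
Let dsumZDl x : {morph dsumZ^~ x : a b / a + b}.
Proof. by move=> a b; apply: dsumP => i; exact: scalerDl. Qed.
HB.instance Definition _ :=
  GRing.Zmodule_isLmodule.Build K dsum dsumZA dsumZ1 dsumZDr dsumZDl.
End DirectSum.

(* The subspace spanned by a family g. *)
Section Span.
Variables (K : fieldType) (V : lmodType K) (I : Type) (g : I -> V).

Definition in_span : {pred V} :=
  fun x => `[< exists s : seq (K * I), x = \sum_(c <- s) c.1 *: g c.2 >].

Let in_span_submod : submod_closed in_span.
Proof.
split; first by apply/asboolP; exists [::]; rewrite big_nil.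
move=> a _ _ /asboolP[s ->] /asboolP[t ->]; apply/asboolP.
exists ([seq (a * c.1, c.2) | c <- s] ++ t).
rewrite big_cat big_map scaler_sumr; congr (_ + _).
by apply: eq_bigr => c _; rewrite scalerA.
Qed.
HB.instance Definition _ := GRing.isSubmodClosed.Build K V in_span in_span_submod.

Definition span_of := {x : V | in_span x}.
HB.instance Definition _ := Choice.on span_of.
HB.instance Definition _ := SubType.on span_of.
HB.instance Definition _ := [SubChoice_isSubLmodule of span_of by <:].

Lemma span_gen_subproof i : in_span (g i).
Proof. by apply/asboolP; exists [:: (1, i)]; rewrite big_seq1 scale1r. Qed.
Definition span_gen i : span_of := exist _ (g i) (span_gen_subproof i).
End Span.

Section Dendriform.
Variable K : fieldType.

Definition dendriform (A : lmodType K) (prec succ : A -> A -> A) : Prop :=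
  let star x y := prec x y + succ x y in
  [/\ (forall x, linear (prec x)) /\ (forall y, linear (prec^~ y)),
      (forall x, linear (succ x)) /\ (forall y, linear (succ^~ y))
    & forall x y z,
      [/\ prec (prec x y) z = prec x (star y z),
          prec (succ x y) z = succ x (prec y z)
        & succ (star x y) z = succ x (succ y z)]].

Section Augmentation.
Variables (A : lmodType K) (prec succ : A -> A -> A).

(* The augmentation A (+) K 1, with a + l 1 encoded as (a, l). The operations are
   partial because 1 < 1 and 1 > 1 are undefined: with x = a + l 1 and
   y = b + m 1, bilinearity makes both undefined exactly when l * m != 0. *)
Definition aug : lmodType K := (A * K^o)%type.
Definition aug_one : aug := (0, 1).
Definition aug_prec (x y : aug) : option aug :=
  if x.2 * y.2 == 0 then Some (prec x.1 y.1 + y.2 *: x.1, 0) else None.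
Definition aug_succ (x y : aug) : option aug :=
  if x.2 * y.2 == 0 then Some (succ x.1 y.1 + x.2 *: y.1, 0) else None.
End Augmentation.

(* (V, one, prec, succ) is the augmentation of some dendriform algebra A, up to
   a linear isomorphism f preserving the unit and the partial operations. *)
Definition augmented_dendriform (V : lmodType K) (one : V)
    (prec succ : V -> V -> option V) : Prop :=
  exists (A : lmodType K) (p s : A -> A -> A) (f : {linear V -> aug A}),
    [/\ dendriform p s, bijective f, f one = aug_one A,
        forall x y, omap f (prec x y) = aug_prec p (f x) (f y)
      & forall x y, omap f (succ x y) = aug_succ s (f x) (f y)].
End Dendriform.

Lemma sigma_finite_product d1 d2 (T1 : measurableType d1)
    (T2 : measurableType d2) (R : realType)
    (m1 : {sigma_finite_measure set T1 -> \bar R})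
    (m2 : {sigma_finite_measure set T2 -> \bar R}) :
  sigma_finite setT (m1 \x m2)%E.
Proof.
have /sigma_finiteP[F [TF ndF Foo]] := sigma_finiteT m1.
have /sigma_finiteP[G [TG ndG Goo]] := sigma_finiteT m2.
exists (fun n => F n `*` G n)%classic.
 rewrite -setXTT TF TG predeqE => -[x y]; split.
    move=> [/= [n _ Fnx] [k _ Gky]]; exists (maxn n k) => //; split.
    - by move: x Fnx; exact/subsetPset/ndF/leq_maxl.
    - by move: y Gky; exact/subsetPset/ndG/leq_maxr.
  by move=> [n _ []/= ? ?]; split; exists n.
move=> k; have [? ?] := Foo k; have [? ?] := Goo k.
split; first exact: measurableX.
by rewrite product_measure1E// lte_mul_pinfty// ge0_fin_numE.
Qed.

Section LebesgueTuple.
Variable R : realType.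

(* R^n, with its Borel sigma-algebra as a product sigma-algebra. *)
Definition euclid n := n.-tuple (measurableTypeR R).
HB.instance Definition _ n := Measurable.on (euclid n).

Definition euclid_cons n (p : measurableTypeR R * euclid n) : euclid n.+1 :=
  [tuple of p.1 :: p.2].

Lemma measurable_euclid_cons n : measurable_fun [set: _] (@euclid_cons n).
Proof. by apply: measurable_cons. Qed.

Section Step.
Variables (n : nat) (mu : {sigma_finite_measure set (euclid n) -> \bar R}).

Definition lebesgue_step : set (euclid n.+1) -> \bar R :=
  pushforward (@lebesgue_measure R \x mu)%E (@euclid_cons n).

Let lebesgue_step_measure : {measure set (euclid n.+1) -> \bar R} :=
  measure_function_pushforward__canonical__measure_function_Measure
    (@lebesgue_measure R \x mu)%E (@measurable_euclid_cons n).

HB.instance Definition _ := isMeasure.Build _ _ _ lebesgue_step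
  (measure0 lebesgue_step_measure) (measure_ge0 lebesgue_step_measure)
  (@measure_semi_sigma_additive _ _ _ lebesgue_step_measure).

Let lebesgue_step_sigma_finite : sigma_finite setT lebesgue_step.
Proof.
have [F TF mF] : sigma_finite setT (@lebesgue_measure R \x mu)%E
  by exact: sigma_finite_product.
pose g (t : euclid n.+1) := (thead t, [tuple of behead t] : euclid n).
have mg : measurable_fun setT g.
  apply/measurable_fun_pairP; split => /=; first exact: measurable_tnth.
  exact: measurable_behead.
exists (fun k => g @^-1` F k).
  by rewrite -preimage_bigcup -TF preimage_setT.
move=> k; have [mFk Fkoo] := mF k; split.
  by rewrite -[X in measurable X]setTI; exact: mg.
rewrite /lebesgue_step /pushforward.
rewrite -comp_preimage (_ : g \o _ = id) //; apply/funext => -[x t] /=.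
by congr pair; apply: val_inj.
Qed.

HB.instance Definition _ :=
  Measure_isSigmaFinite.Build _ _ _ lebesgue_step lebesgue_step_sigma_finite.
End Step.

(* Lebesgue measure on R^n, as an iterated product; R^0 is one point of mass 1. *)
Fixpoint lebesgue_euclid n : {sigma_finite_measure set (euclid n) -> \bar R} :=
  if n is m.+1 then lebesgue_step (lebesgue_euclid m)
  else \d_([tuple] : euclid 0).

End LebesgueTuple.

Section BorelInt.
Variables (R : realType) (n : nat).

Definition borel_set := {A : set (euclid R n) | `[< measurable A >]}.

Definition borel_of (A : set (euclid R n)) (mA : measurable A) : borel_set :=
  exist _ A (asboolT mA).

Lemma borel_setP (A : borel_set) : measurable (val A).
Proof. exact/asboolP/(valP A). Qed.

Definition borel_setU (A B : borel_set) : borel_set :=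
  borel_of (measurableU _ _ (borel_setP A) (borel_setP B)).
Definition borel_setI (A B : borel_set) : borel_set :=
  borel_of (measurableI _ _ (borel_setP A) (borel_setP B)).
Definition borel_set0 : borel_set := borel_of measurable0.

Lemma val_borel_setU A B : val (borel_setU A B) = val A `|` val B.
Proof. by []. Qed.
Lemma val_borel_setI A B : val (borel_setI A B) = val A `&` val B.
Proof. by []. Qed.
Lemma val_borel_set0 : val borel_set0 = set0.
Proof. by []. Qed.

Local Notation null := ((lebesgue_euclid R n).-negligible).

Definition borel_eqv : rel borel_set :=
  fun A B => `[< null (val A `+` val B) >].

Lemma borel_eqv_equiv : equiv_class_of borel_eqv.
Proof.
split=> [A|A B|B A C].
- by apply/asboolP; rewrite setYK; exact: negligible_set0.
- by rewrite /borel_eqv setYC.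
- move=> /asboolP AB /asboolP BC; apply/asboolP.
  by apply: negligibleS (negligibleU AB BC) => x /=; have := EM (val B x); tauto.
Qed.

Canonical borel_eqv_equivRel := EquivRelPack borel_eqv_equiv.

Definition borel_int := {eq_quot borel_eqv}.
HB.instance Definition _ := Choice.on borel_int.
HB.instance Definition _ := EqQuotient.on borel_int.

Definition borel_int_of (A : borel_set) : borel_int := \pi_borel_int A.

Lemma borel_int_eqP (A B : borel_set) :
  borel_int_of A = borel_int_of B <-> null (val A `+` val B).
Proof.
split=> [/eqP|AB]; first by rewrite /borel_int_of piE => /asboolP.
by apply/eqP; rewrite /borel_int_of piE; apply/asboolP.
Qed.

Definition borel_intU (x y : borel_int) : borel_int :=
  borel_int_of (borel_setU (repr x) (repr y)).
Definition borel_intI (x y : borel_int) : borel_int :=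
  borel_int_of (borel_setI (repr x) (repr y)).
Definition borel_int0 : borel_int := borel_int_of borel_set0.

Lemma borel_int_of_repr (x : borel_int) : borel_int_of (repr x) = x.
Proof. exact: reprK. Qed.

Lemma repr_borel_int_of (A : borel_set) :
  null (val (repr (borel_int_of A)) `+` val A).
Proof. by apply/borel_int_eqP; rewrite borel_int_of_repr. Qed.

Lemma borel_intU_of A B :
  borel_intU (borel_int_of A) (borel_int_of B) = borel_int_of (borel_setU A B).
Proof.
apply/borel_int_eqP; have := repr_borel_int_of B; have := repr_borel_int_of A.
by move=> nA nB; apply: negligibleS (negligibleU nA nB) => x;
  rewrite !(val_borel_setU, val_borel_setI);
  move: (EM (val A x)) (EM (val (repr (borel_int_of A)) x)) => /=; tauto.
Qed.

Lemma borel_intI_of A B :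
  borel_intI (borel_int_of A) (borel_int_of B) = borel_int_of (borel_setI A B).
Proof.
apply/borel_int_eqP; have := repr_borel_int_of B; have := repr_borel_int_of A.
by move=> nA nB; apply: negligibleS (negligibleU nA nB) => x;
  rewrite !(val_borel_setU, val_borel_setI);
  move: (EM (val A x)) (EM (val (repr (borel_int_of A)) x)) => /=; tauto.
Qed.

Lemma borel_intP (P : borel_int -> Prop) :
  (forall A, P (borel_int_of A)) -> forall x, P x.
Proof. by move=> PA x; rewrite -(borel_int_of_repr x). Qed.

Lemma borel_intUA : associative borel_intU.
Proof.
elim/borel_intP=> A; elim/borel_intP=> B; elim/borel_intP=> C.
rewrite !borel_intU_of; congr borel_int_of; apply: val_inj.
exact: setUA.
Qed.

Lemma borel_intUC : commutative borel_intU.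
Proof.
elim/borel_intP=> A; elim/borel_intP=> B.
by rewrite !borel_intU_of; congr borel_int_of; apply: val_inj; exact: setUC.
Qed.

Lemma borel_int0U : left_id borel_int0 borel_intU.
Proof.
elim/borel_intP=> A; rewrite borel_intU_of; congr borel_int_of.
by apply: val_inj; exact: set0U.
Qed.

Lemma borel_intU0 : right_id borel_int0 borel_intU.
Proof. by move=> x; rewrite borel_intUC borel_int0U. Qed.

Lemma borel_intU_eq0 x y :
  borel_intU x y = borel_int0 -> x = borel_int0 /\ y = borel_int0.
Proof.
elim/borel_intP: x => A; elim/borel_intP: y => B.
rewrite borel_intU_of => /borel_int_eqP nAB.
by split; apply/borel_int_eqP; apply: negligibleS nAB => x;
  rewrite !(val_borel_setU, val_borel_set0) /=; tauto.
Qed.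

(* The product of basis elements in the algebra {malg K[borel_int]} is the union
   and its unit is the class of the empty set. *)
HB.instance Definition _ := Choice_isMonomialDef.Build borel_int
  borel_intUA borel_int0U borel_intU0 borel_intU_eq0.
HB.instance Definition _ :=
  MonomialDef_isConomialDef.Build borel_int borel_intUC.

End BorelInt.

Global Opaque borel_int_of borel_intU borel_intI borel_int0.

Lemma scalar_line (K : fieldType) (V : lmodType K) (m : {scalar V}) (b : V)
    (a : K) (p q : V) :
  p = m p *: b -> q = m q *: b -> a *: p + q = m (a *: p + q) *: b.
Proof. by move=> pE qE; rewrite linearP scalerDl -scalerA -pE -qE. Qed.

Section FormalBorel.
Variables (K : fieldType) (R : realType) (n : nat).

Definition incl_excl (AB : borel_int R n * borel_int R n) :
    {malg K[borel_int R n]} :=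
  let: (A, B) := AB in
  << borel_intU A B >> - << A >> - << B >> + << borel_intI A B >>.

Definition incl_excl_ideal : {pred {malg K[borel_int R n]}} :=
  gen_ideal incl_excl.

(* The map B |-> 1 turns unions into products and kills the inclusion-exclusion
   relations, so every Borel set has a nonzero class in the quotient; hence the
   ideal is proper and the formal Chen integrals are linearly independent. *)
Definition unit_weight (x : borel_int R n) : K := 1.
Let unit_weight_mmorphism : mmorphism unit_weight.
Proof. by split=> // x y; rewrite mulr1. Qed.
HB.instance Definition _ :=
  isMultiplicative.Build (borel_int R n) K unit_weight unit_weight_mmorphism.

Definition malg_mass : {malg K[borel_int R n]} -> K := mmap idfun unit_weight.
HB.instance Definition _ := GRing.RMorphism.on malg_mass.
HB.instance Definition _ := GRing.Linear.on malg_mass.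

Lemma malg_massU x : malg_mass << x >> = 1.
Proof. by rewrite /malg_mass mmapU mulr1. Qed.

Let malg_massD p q : malg_mass (p + q) = malg_mass p + malg_mass q.
Proof. exact: raddfD. Qed.
Let malg_massB p q : malg_mass (p - q) = malg_mass p - malg_mass q.
Proof. exact: raddfB. Qed.

Lemma malg_mass_incl_excl AB : malg_mass (incl_excl AB) = 0.
Proof.
case: AB => A B.
suff mass0 p q r s : malg_mass p = 1 -> malg_mass q = 1 -> malg_mass r = 1 ->
    malg_mass s = 1 -> malg_mass (p - q - r + s) = 0.
  by apply: mass0; exact: malg_massU.
rewrite malg_massD !malg_massB => -> -> -> ->.
by rewrite subrr sub0r addNr.
Qed.

Lemma malg_mass_ideal p : p \in incl_excl_ideal -> malg_mass p = 0.
Proof. exact: gen_ideal_kernel malg_mass_incl_excl. Qed.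

Let incl_excl_ideal_proper : 1 \notin incl_excl_ideal.
Proof.
apply/negP => /malg_mass_ideal; rewrite [LHS]rmorph1.
by apply/eqP/oner_neq0.
Qed.
HB.instance Definition _ := isIdealr.Build _ incl_excl_ideal
  (gen_ideal_closed incl_excl_ideal_proper).

Definition formal_borel : lmodType K := alg_quot incl_excl_ideal.

Definition formal_borel_of (A : borel_int R n) : formal_borel :=
  alg_quot_pi incl_excl_ideal << A >>.

Definition mass : formal_borel -> K := alg_quot_lift malg_mass.

Lemma mass_linear : scalar mass.
Proof. exact: alg_quot_lift_linear malg_mass_ideal. Qed.
HB.instance Definition _ :=
  GRing.isLinear.Build K formal_borel K *%R mass mass_linear.

Lemma mass_of A : mass (formal_borel_of A) = 1.
Proof.
exact: etrans (alg_quot_lift_pi malg_mass_ideal _) (malg_massU _).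
Qed.

End FormalBorel.

Section Simplex.
Variables (R : realType) (n : nat).

Definition simplex : set (euclid R n) :=
  [set t | sorted <%R (0 :: rcons t (1 : R))].

Lemma measurable_simplex : measurable simplex.
Proof.
pose c i (t : euclid R n) : R := nth 0 (0 :: rcons t (1 : R)) i.
have mc i : measurable_fun setT (c i).
  case: i => [|i]; first exact: measurable_cst.
  have [ni|in_] := leqP n i.
    rewrite (_ : c i.+1 = cst (if i == n then 1 else 0)) //.
    apply/funext => t; rewrite /c /= nth_rcons size_tuple ltnNge ni /=.
    by case: eqP.
  rewrite (_ : c i.+1 = (@tnth n _)^~ (Ordinal in_)).
    exact: measurable_tnth.
  by apply/funext => t; rewrite /c /= nth_rcons size_tuple in_ (tnth_nth 0).
rewrite (_ : simplex = \bigcap_(i < n.+1) [set t | c i t < c i.+1 t]).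
  apply: bigcap_measurable => [|i _]; first by exists 0%N.
  rewrite -[X in measurable X]setTI.
  have := measurable_realfun.measurable_fun_ltr (mc i) (mc i.+1).
  by move=> /(_ measurableT [set true]); apply.
apply/seteqP; split=> t /=.
  by move/(pathP 0) => tP i /= iN; apply: tP; rewrite size_rcons size_tuple.
move=> tP; apply/(pathP 0) => i; rewrite size_rcons size_tuple => iN.
exact: tP.
Qed.

End Simplex.

(* For n = 0 the unit is the formal integral over the empty subset of R^0, not
   over R^0 itself (the simplex of dimension 0); the two are distinct. *)
Definition chen_domain (R : realType) n : borel_int R n :=
  if n is 0 then borel_int0 R n
  else borel_int_of (borel_of (@measurable_simplex R n)).

Section FormalIntegral.
Variables (K : fieldType) (R : realType) (Omega : choiceType).

(* The direct sum over words w of B(R^(size w)) (x) w. *)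
Definition formal_sum : lmodType K :=
  dsum (fun w : seq Omega => formal_borel K R (size w)).

Definition formal_integral := (formal_sum * (Omega -> R -> R))%type.

Section At.
Variable G : Omega -> R -> R.

(* The formal integrals with second component G; the vector space structure is
   that of the first component. *)
Definition formal_at := {p : formal_integral | p.2 == G}.
HB.instance Definition _ := Choice.on formal_at.

Definition formal_at_mk (x : formal_sum) : formal_at :=
  exist (fun p : formal_integral => p.2 == G) (x, G) (eqxx G).

Definition formal_at_val (p : formal_at) : formal_sum := (val p).1.

Lemma formal_at_valK : cancel formal_at_val formal_at_mk.
Proof.
by case=> -[x H] HG; apply: val_inj; congr pair; apply/esym/eqP.
Qed.

Lemma formal_at_mkK : cancel formal_at_mk formal_at_val.
Proof. by []. Qed.

Let fadd (x y : formal_at) := formal_at_mk (formal_at_val x + formal_at_val y).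
Let fopp (x : formal_at) := formal_at_mk (- formal_at_val x).
Let fscale (a : K) (x : formal_at) := formal_at_mk (a *: formal_at_val x).
Let fzero := formal_at_mk 0.

Let faddA : associative fadd.
Proof. by move=> x y z; rewrite /fadd addrA. Qed.
Let faddC : commutative fadd.
Proof. by move=> x y; rewrite /fadd addrC. Qed.
Let fadd0 : left_id fzero fadd.
Proof. by move=> x; rewrite /fadd add0r formal_at_valK. Qed.
Let faddN : left_inverse fzero fopp fadd.
Proof. by move=> x; rewrite /fadd addNr. Qed.
HB.instance Definition _ :=
  GRing.isZmodule.Build formal_at faddA faddC fadd0 faddN.
Let fscaleA a b x : fscale a (fscale b x) = fscale (a * b) x.
Proof. by rewrite /fscale scalerA. Qed.
Let fscale1 : left_id 1 fscale.
Proof. by move=> x; rewrite /fscale scale1r formal_at_valK. Qed.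
Let fscaleDr : right_distributive fscale +%R.
Proof. by move=> a x y; rewrite /fscale scalerDr. Qed.
Let fscaleDl x : {morph fscale^~ x : a b / a + b}.
Proof. by move=> a b; rewrite /fscale scalerDl. Qed.
HB.instance Definition _ :=
  GRing.Zmodule_isLmodule.Build K formal_at fscaleA fscale1 fscaleDr fscaleDl.

Definition chen_integral (w : seq Omega) : formal_at :=
  formal_at_mk
    (@dsum_single K _ _ w (formal_borel_of K (chen_domain R (size w)))).

Definition chen_space : lmodType K := span_of chen_integral.
Definition chen (w : seq Omega) : chen_space := span_gen chen_integral w.
Definition chen_one : chen_space := chen [::].

(* The coefficient of x on chen w: see chen_val_coef below. *)
Definition chen_coef (x : chen_space) (w : seq Omega) : K :=
  mass (dsum_fun (formal_at_val (val x)) w).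

(* Positions 1, .., k + l are the ordinals 0, .., k + l - 1. *)
Definition is_shuffle k l (s : 'S_(k + l)) : bool :=
  [forall i : 'I_k, forall j : 'I_k,
     (i < j)%N ==> (s (lshift l i) < s (lshift l j))%N] &&
  [forall i : 'I_l, forall j : 'I_l,
     (i < j)%N ==> (s (rshift k i) < s (rshift k j))%N].

(* The condition s^-1(1) = m + 1, in 1-based numbering. *)
Definition first_from n (s : 'S_n) (m : nat) : bool :=
  [forall i : 'I_n, (i == 0 :> nat) ==> ((s^-1)%g i == m :> nat)].

Definition shuffle_word (u v : seq Omega) (s : 'S_(size u + size v)) :
    seq Omega :=
  [tuple tnth (cat_tuple (in_tuple u) (in_tuple v)) ((s^-1)%g i)
    | i < size u + size v].

(* The values at ([::], [::]) are never used: 1 < 1 and 1 > 1 are undefined. *)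
Definition chen_prec_word (u v : seq Omega) : chen_space :=
  match u, v with
  | [::], _ => 0
  | _, [::] => chen u
  | _, _ => \sum_(s : 'S_(size u + size v) | is_shuffle s && first_from s 0)
              chen (shuffle_word s)
  end.

Definition chen_succ_word (u v : seq Omega) : chen_space :=
  match u, v with
  | _, [::] => 0
  | [::], _ => chen v
  | _, _ => \sum_(s : 'S_(size u + size v)
                   | is_shuffle s && first_from s (size u))
              chen (shuffle_word s)
  end.

(* Bilinear extension of op, undefined as soon as the pair (1, 1) occurs with a
   nonzero coefficient. *)
Definition bilinear_ext (op : seq Omega -> seq Omega -> chen_space)
    (x y : chen_space) : option chen_space :=
  if chen_coef x [::] * chen_coef y [::] == 0 then
    Some (\sum_(p \in [set: seq Omega * seq Omega])
            (chen_coef x p.1 * chen_coef y p.2) *: op p.1 p.2)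
  else None.

Definition chen_prec := bilinear_ext chen_prec_word.
Definition chen_succ := bilinear_ext chen_succ_word.

Lemma chen_coef_chen u w : chen_coef (chen u) w = (w == u)%:R.
Proof.
rewrite /chen_coef /= /formal_at_val /= /dsum_fun /=.
case: dfwithP => [|v uv]; first by rewrite eqxx mass_of.
by rewrite eq_sym (negPf uv) [LHS]raddf0.
Qed.

Lemma chen_val_coef (x : chen_space) w :
  dsum_fun (formal_at_val (val x)) w =
  chen_coef x w *: formal_borel_of K (chen_domain R (size w)).
Proof.
case: x => y yS; rewrite /chen_coef [val _]/=.
have /asboolP[s ->] := yS; elim: s => [|[a u] s IHs].
  by rewrite big_nil [dsum_fun _ w]/= [mass _]raddf0 scale0r.
rewrite big_cons; set z := \sum_(c <- s) _ in IHs *.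
suff coef_chen :
    dsum_fun (formal_at_val (chen_integral u)) w =
    mass (dsum_fun (formal_at_val (chen_integral u)) w) *:
      formal_borel_of K (chen_domain R (size w)).
  exact: (@scalar_line K _ (@mass K R (size w)) _ a _ _ coef_chen IHs).
rewrite /dsum_fun /=; case: dfwithP => [|v uv].
  by rewrite mass_of scale1r.
by rewrite [mass _]raddf0 scale0r.
Qed.

Lemma chen_coef_linear w : scalar (chen_coef^~ w).
Proof. by move=> a x y; exact: mass_linear. Qed.

Lemma chen_coef_inj (x y : chen_space) : chen_coef x =1 chen_coef y -> x = y.
Proof.
move=> xy; apply: val_inj; apply: (can_inj formal_at_valK); apply: dsumP => w.
by rewrite !chen_val_coef xy.
Qed.

Lemma chen_coef_finite (x : chen_space) :
  finite_set [set w | chen_coef x w != 0].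
Proof.
apply: sub_finite_set (dsum_finite (formal_at_val (val x))) => w /=.
by apply: contraNN => /eqP x0; rewrite /chen_coef x0 [mass _]raddf0.
Qed.

Lemma bilinear_ext_chen op u v : (u, v) != ([::], [::]) ->
  bilinear_ext op (chen u) (chen v) = Some (op u v).
Proof.
move=> uv; rewrite /bilinear_ext !chen_coef_chen -natrM mulnb.
rewrite (_ : _ && _ = false) ?eqxx; last first.
  by apply: contraNF uv => /andP[/eqP <- /eqP <-].
congr Some; rewrite (fsbigE [:: (u, v)]) //=; last first.
  move=> -[u' v'] /= _; rewrite !chen_coef_chen inE -natrM mulnb xpair_eqE.
  by move/negPf ->; rewrite scale0r.
rewrite big_cons big_nil classical_sets.in_setT.
by rewrite !chen_coef_chen !eqxx mulr1 scale1r addr0.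
Qed.

End At.
End FormalIntegral.

(* Main.v *)
(** Both operations can be read on words: [u < v] (resp. [u > v]) is the sum of
    the shuffles of [u] and [v] whose first letter comes from [u] (resp. [v]).
    A shuffle permutation [s] is determined by [j = s^-1(1)], which is the first
    position of one of the two blocks, and by the shuffle left after deleting
    [j]; this turns the sums over [Sh(k, l)] into the recursion
    [a u < v = a (u * v)] and [u > b v = b (u * v)], with [* = (<) + (>)].
    Deleting the common first letter, each dendriform identity becomes an
    instance of the associativity of [*], which is in turn the sum of the three
    identities.

    Since [chen w] is a basis of the space, everything extends by bilinearity to
    the ideal of elements without component on the empty word, whose
    augmentation is the whole space. *)
Require Import Defs.
From HB Require Import structures.
From mathcomp Require Import all_boot all_order all_algebra.
From mathcomp Require Import perm zify.
From mathcomp Require Import all_classical all_reals all_analysis.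

Set Implicit Arguments.
Unset Strict Implicit.
Unset Printing Implicit Defensive.

Import GRing.Theory.

Local Open Scope classical_set_scope.
Local Open Scope ring_scope.

(** * Shuffles of words and associativity of their product *)

Section WordShuffles.
Variable T : Type.
Implicit Types u v w x y z : seq T.

(** The inner [fix] is there because each recursive call shortens only one of the two words. *)
Fixpoint shuffles u : seq T -> seq (seq T) :=
  if u is a :: u' then
    fix shuffles_u v := if v is b :: v' then
      map (cons a) (shuffles u' v) ++ map (cons b) (shuffles_u v')
    else [:: u]
  else fun v => [:: v].

Definition left_shuffles u v :=
  if u is a :: u' then map (cons a) (shuffles u' v) else [::].

Definition right_shuffles u v :=
  if v is b :: v' then map (cons b) (shuffles u v') else [::].

Lemma shuffles0l v : shuffles [::] v = [:: v]. Proof. by []. Qed.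

Lemma shuffles0r u : shuffles u [::] = [:: u]. Proof. by case: u. Qed.

(** Two empty words are excluded: their only shuffle is empty, hence has no first letter and lies in
    neither half. *)
Lemma shufflesE u v : (0 < size u + size v)%N ->
  shuffles u v = left_shuffles u v ++ right_shuffles u v.
Proof. by case: u v => [|a u] [|b v] //= _; rewrite ?shuffles0r. Qed.

Arguments shuffles : simpl never.
Arguments left_shuffles : simpl never.
Arguments right_shuffles : simpl never.

Section Sums.
Variable V : nmodType.
Implicit Type F : seq T -> V.

Lemma sum_left_shuffles F a u v :
  \sum_(w <- left_shuffles (a :: u) v) F w =
  \sum_(w <- shuffles u v) F (a :: w).
Proof. exact: big_map. Qed.

Lemma sum_right_shuffles F b u v :
  \sum_(w <- right_shuffles u (b :: v)) F w =
  \sum_(w <- shuffles u v) F (b :: w).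
Proof. exact: big_map. Qed.

Definition half_shufflesE := (sum_left_shuffles, sum_right_shuffles).

Lemma sum_shuffles F u v : (0 < size u + size v)%N ->
  \sum_(w <- shuffles u v) F w =
  \sum_(w <- left_shuffles u v) F w + \sum_(w <- right_shuffles u v) F w.
Proof. by move=> uv; rewrite shufflesE// big_cat. Qed.

Lemma eq_sum_left_shuffles F F' u v : (forall a w, F (a :: w) = F' (a :: w)) ->
  \sum_(w <- left_shuffles u v) F w = \sum_(w <- left_shuffles u v) F' w.
Proof.
case: u => [|a u] FF'; first by rewrite !big_nil.
by rewrite !half_shufflesE; apply: eq_bigr.
Qed.

Lemma eq_sum_right_shuffles F F' u v : (forall a w, F (a :: w) = F' (a :: w)) ->
  \sum_(w <- right_shuffles u v) F w = \sum_(w <- right_shuffles u v) F' w.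
Proof.
case: v => [|a v] FF'; first by rewrite !big_nil.
by rewrite !half_shufflesE; apply: eq_bigr.
Qed.

Lemma eq_sum_shuffles F F' u v : (0 < size u + size v)%N ->
    (forall a w, F (a :: w) = F' (a :: w)) ->
  \sum_(w <- shuffles u v) F w = \sum_(w <- shuffles u v) F' w.
Proof.
move=> uv FF'; rewrite !sum_shuffles//.
by congr (_ + _); [apply: eq_sum_left_shuffles|apply: eq_sum_right_shuffles].
Qed.

(** Testing against every [F] compares the two lists of shuffles up to order, and leaves room to
    replace [F] by [fun t => F (a :: t)]. *)
Definition shufflesA_at x y z := forall F,
  \sum_(w <- shuffles x y) \sum_(t <- shuffles w z) F t =
  \sum_(w <- shuffles y z) \sum_(t <- shuffles x w) F t.

(** Every word on either side starts with [a]; deleting it leaves associativity at the shorter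
    triple. The next two lemmas do the same with the first letter of the second and of the third
    word. *)
Lemma left_left_shuffles F a x y z : shufflesA_at x y z ->
  \sum_(w <- left_shuffles (a :: x) y) \sum_(t <- left_shuffles w z) F t =
  \sum_(w <- shuffles y z) \sum_(t <- left_shuffles (a :: x) w) F t.
Proof.
move=> xyz; rewrite !half_shufflesE.
under [LHS]eq_bigr do rewrite half_shufflesE.
by under [RHS]eq_bigr do rewrite half_shufflesE;
  exact: (xyz (fun t => F (a :: t))).
Qed.

Lemma right_left_shuffles F x b y z : shufflesA_at x y z ->
  \sum_(w <- right_shuffles x (b :: y)) \sum_(t <- left_shuffles w z) F t =
  \sum_(w <- left_shuffles (b :: y) z) \sum_(t <- right_shuffles x w) F t.
Proof.
move=> xyz; rewrite !half_shufflesE.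
under [LHS]eq_bigr do rewrite half_shufflesE.
by under [RHS]eq_bigr do rewrite half_shufflesE;
  exact: (xyz (fun t => F (b :: t))).
Qed.

Lemma right_right_shuffles F x y c z : shufflesA_at x y z ->
  \sum_(w <- shuffles x y) \sum_(t <- right_shuffles w (c :: z)) F t =
  \sum_(w <- right_shuffles y (c :: z)) \sum_(t <- right_shuffles x w) F t.
Proof.
move=> xyz; rewrite !half_shufflesE.
under [LHS]eq_bigr do rewrite half_shufflesE.
by under [RHS]eq_bigr do rewrite half_shufflesE;
  exact: (xyz (fun t => F (c :: t))).
Qed.

Lemma shufflesA x y z : shufflesA_at x y z.
Proof.
(* The induction is on a bound for the total length, since the deleted letter may come from any of
   the three words. *)
move: {2}(_ + _)%N (leqnn (size x + size y + size z)%N) => n.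
elim: n x y z => [|n IHn] x y z.
  by case: x y z => [|? ?] [|? ?] [|? ?] // _ F; rewrite !big_seq1.
case: x => [|a x].
  by move=> _ F; rewrite big_seq1; under [RHS]eq_bigr do rewrite big_seq1.
case: y => [|b y]; first by move=> _ F; rewrite shuffles0r !big_seq1.
case: z => [|c z].
  move=> _ F; rewrite !shuffles0r big_seq1.
  by apply: eq_bigr => w _; rewrite shuffles0r big_seq1.
move=> leq_n F.
rewrite (@eq_sum_shuffles _ (fun w =>
   \sum_(t <- left_shuffles w (c :: z)) F t +
   \sum_(t <- right_shuffles w (c :: z)) F t)) => // [|d w]; last first.
  exact: sum_shuffles.
rewrite big_split /= sum_shuffles// -addrA.
rewrite [RHS](@eq_sum_shuffles _ (fun w =>
   \sum_(t <- left_shuffles (a :: x) w) F t +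
   \sum_(t <- right_shuffles (a :: x) w) F t)) => // [|d w]; last first.
  exact: sum_shuffles.
rewrite big_split /= [X in _ = _ + X]sum_shuffles//.
(* Both sides are now split in three, according to the word that provides the first letter. *)
congr (_ + (_ + _)).
- by apply: left_left_shuffles; exact: IHn.
- by apply: right_left_shuffles; apply: IHn;
    move: leq_n; rewrite /= !addnS !addSn.
- by apply: right_right_shuffles; apply: IHn;
    move: leq_n; rewrite /= !addnS !addSn.
Qed.
End Sums.
End WordShuffles.

(** * Sums over shuffle permutations as sums over shuffles of words *)

Section PermutationShuffles.
Variables (T : Type) (V : nmodType).

(* Indexing by an arbitrary [n] rather than [k + l] avoids casts when the first
   letter of the second block is removed. *)
Definition shuffle_perm n (k : nat) (s : 'S_n) : bool :=
  [forall i : 'I_n, forall j : 'I_n,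
    ((i < j) && ((j < k) || (k <= i)))%N ==> (s i < s j)%N].

Lemma shuffle_permP n k (s : 'S_n) :
  reflect (forall i j : 'I_n, (i < j)%N -> (j < k)%N || (k <= i)%N ->
             (s i < s j)%N)
          (shuffle_perm k s).
Proof.
apply: (iffP 'forall_forallP) => sP i j; first by move=> ij ijk;
  apply: (implyP (sP i j)); rewrite ij.
by apply/implyP => /andP[]; exact: sP.
Qed.

Lemma is_shuffleE k l (s : 'S_(k + l)) : is_shuffle s = shuffle_perm k s.
Proof.
apply/andP/shuffle_permP => [[/'forall_forallP sl /'forall_forallP sr] i j|sP].
  case: (split_ordP i) => i' ->; case: (split_ordP j) => j' -> /= ij.
  - by move=> _; apply: (implyP (sl _ _)).
  - by have := ltn_ord i'; lia.
  - by have := ltn_ord j'; lia.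
  - by move=> _; apply: (implyP (sr _ _)); lia.
split; apply/'forall_forallP => i j; apply/implyP => ij; apply: sP => //=.
- by rewrite ltn_ord.
- by rewrite ltn_add2l.
- by rewrite leq_addr orbT.
Qed.

(** The permutations sending [j] to the first position are exactly the [lift_perm j ord0 s], each
    for a single [s]. *)
Lemma sum_perm_first n (j : 'I_n.+1) (P : pred 'S_n.+1) (F : 'S_n.+1 -> V) :
  \sum_(s | P s && first_from s j) F s =
  \sum_(s | P (lift_perm j ord0 s)) F (lift_perm j ord0 s).
Proof.
have firstE s : first_from s j = (s j == ord0).
  apply/forallP/eqP => [/(_ ord0)/= /eqP/val_inj <-|sj i].
    by rewrite permKV.
  apply/implyP => /eqP i0; rewrite (_ : i = s j) ?permK//.
  by apply: val_inj; rewrite sj.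
under eq_bigl do rewrite firstE.
rewrite big_mkcondl [RHS]big_mkcond.
rewrite -(big_imset (fun s => if P s then F s else 0) (A := mem 'S_n)) /=;
    last first.
  move=> s t _ _ st; apply/permP => k; apply: (@lift_inj _ ord0).
  by rewrite -!(lift_perm_lift j) st.
apply: eq_bigl => s.
apply/eqP/imsetP => [sj|[t _ ->]]; last exact: lift_perm_id.
(* Delete [j] from the source and the first position from the target. The default is never reached,
   as only [j] is sent to [ord0]. *)
pose f k := odflt k (unlift ord0 (s (lift j k))).
have fK k : lift ord0 (f k) = s (lift j k).
  have: s j != s (lift j k) by rewrite (inj_eq perm_inj) neq_lift.
  by rewrite sj /f => /unlift_some[i -> ->].
have f_inj : injective f.
  by move=> k k' /(congr1 (lift ord0)); rewrite !fK => /perm_inj/lift_inj.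
exists (perm f_inj) => //; apply/permP => k.
by case: (unliftP j k) => [k' ->|->];
  rewrite ?lift_perm_lift ?lift_perm_id// permE fK.
Qed.

(** Since [j] starts a block and goes to the first position, the pairs containing it impose no
    condition. Deleting it moves the block boundary only if it lies in the first block. *)
Lemma shuffle_perm_lift n (j : 'I_n.+1) k (s : 'S_n) :
    (j == 0 :> nat) || (j == k :> nat) ->
  shuffle_perm k (lift_perm j ord0 s) = shuffle_perm (k - (j < k)) s.
Proof.
move=> j0k; apply/shuffle_permP/shuffle_permP => sP i i' ii'.
  move=> ik; have := sP (lift j i) (lift j i').
  rewrite !lift_perm_lift !lift0 ltnS; apply; rewrite /= /bump; lia.
case: (unliftP j i') => [m'|] Ei'; last first.
  by move: ii'; rewrite Ei' => ij /orP[]; lia.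
case: (unliftP j i) => [m|] Ei; last first.
  by rewrite Ei Ei' lift_perm_id lift_perm_lift.
move: ii'; rewrite Ei Ei' !lift_perm_lift !lift0 ltnS /= /bump => ii' ik.
by apply: sP; lia.
Qed.

(** If the preimage of the first position did not start its block, the start of that block would
    have to be sent strictly before the first position. *)
Lemma shuffle_perm_first n k (s : 'S_n.+1) :
    (k <= n.+1)%N -> shuffle_perm k s ->
  first_from s 0 || first_from s k.
Proof.
move=> kn /shuffle_permP sP; rewrite /first_from.
set j := (s^-1)%g ord0.
have sj : s j = ord0 by rewrite permKV.
have jE m : (j == m :> nat) ->
    [forall i : 'I_n.+1, (i == 0 :> nat) ==> ((s^-1)%g i == m :> nat)].
  move=> jm; apply/forallP => i; apply/implyP => /eqP i0.
  by rewrite (_ : i = ord0)//; exact: val_inj.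
have [j0|jN0] := eqVneq (j : nat) 0%N; first by rewrite jE ?j0.
have [jk|jNk] := eqVneq (j : nat) k; first by rewrite orbC jE ?jk.
have [jk|kj] := ltnP j k.
  by have := sP ord0 j; rewrite sj jk lt0n jN0 => /(_ isT isT).
have kn' : (k < n.+1)%N by apply: leq_ltn_trans (ltn_ord j).
have := sP (Ordinal kn') j; rewrite sj /= leqnn orbT ltn_neqAle eq_sym jNk kj.
by move=> /(_ isT isT).
Qed.

Section Words.
Variable x0 : T.

(** Reading letters with a default, rather than from a tuple, keeps [n] independent of the form of
    [w]. *)
Definition perm_word n (w : seq T) (s : 'S_n) : seq T :=
  [seq nth x0 w ((s^-1)%g i) | i <- enum 'I_n].

Lemma perm_word_lift n (j : 'I_n.+1) u b v (s : 'S_n) : j = size u :> nat ->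
  perm_word (u ++ b :: v) (lift_perm j ord0 s) = b :: perm_word (u ++ v) s.
Proof.
move=> ju; rewrite /perm_word enum_ordSl /= lift_permV lift_perm_id ju.
rewrite nth_cat ltnn subnn -map_comp; congr (_ :: _); apply: eq_map => i /=.
rewrite lift_perm_lift /= ju !nth_cat /bump.
(* Letters after the deleted one have moved down by one place, which [bump] undoes. *)
have [ui|iu] := leqP (size u) (s^-1%g i); last by rewrite add0n iu.
by rewrite add1n ltnNge ltnW//= subSn.
Qed.

Definition perm_shuffles_spec n := forall (u v : seq T) (F : seq T -> V),
  n = (size u + size v)%N ->
  \sum_(s : 'S_n | shuffle_perm (size u) s) F (perm_word (u ++ v) s) =
  \sum_(w <- shuffles u v) F w.

(** The case [n] is a hypothesis because this step serves inside the induction of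
    [sum_perm_shuffles] and again after it, for [chen_prec_wordE]. *)
Lemma sum_perm_left_step n a u v (F : seq T -> V) :
    perm_shuffles_spec n -> n = (size u + size v)%N ->
  \sum_(s : 'S_n.+1 | shuffle_perm (size u).+1 s && first_from s 0)
     F (perm_word ((a :: u) ++ v) s) =
  \sum_(w <- left_shuffles (a :: u) v) F w.
Proof.
move=> IHn nE; rewrite sum_left_shuffles -IHn//.
rewrite (@sum_perm_first _ ord0); apply: eq_big => [s|s _].
  by rewrite shuffle_perm_lift// subn1.
by rewrite (@perm_word_lift _ _ [::]).
Qed.

Lemma sum_perm_right_step n u b v (F : seq T -> V) :
    perm_shuffles_spec n -> n = (size u + size v)%N ->
  \sum_(s : 'S_n.+1 | shuffle_perm (size u) s && first_from s (size u))
     F (perm_word (u ++ b :: v) s) =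
  \sum_(w <- right_shuffles u (b :: v)) F w.
Proof.
move=> IHn nE; have un : (size u < n.+1)%N by rewrite ltnS nE leq_addr.
rewrite sum_right_shuffles -IHn// (@sum_perm_first _ (Ordinal un)).
apply: eq_big => [s|s _]; last by rewrite perm_word_lift.
by rewrite shuffle_perm_lift /= ?eqxx ?orbT// ltnn subn0.
Qed.

Lemma sum_perm_shuffles n : perm_shuffles_spec n.
Proof.
elim: n => [|n IHn] u v F.
  case: u v => [|//] [|//] _; rewrite big_seq1 (big_pred1 (1%g : 'S_0)) => [|s].
    rewrite /perm_word (eqP (_ : enum 'I_0 == [::]))//.
    by rewrite -size_eq0 -cardE card_ord.
  rewrite [RHS](_ : _ = true); last by apply/eqP/permP => -[].
  by apply/shuffle_permP => -[].
have first_only m (s : 'S_n.+1) (k : nat) :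
    m != k -> first_from s k -> ~~ first_from s m.
  move=> mk /forallP/(_ ord0)/= /eqP sk; apply/negP => /forallP/(_ ord0)/=.
  by rewrite sk eq_sym (negPf mk).
move=> nE; rewrite sum_shuffles -?nE//.
case: u v nE => [|a u] [|b v] // nE.
(* With [u] empty both blocks start at position 0, so every shuffle belongs to the right half. *)
- rewrite [X in _ = X + _]big_nil add0r -(@sum_perm_right_step n)//;
    last by case: nE.
  apply: eq_bigl => s; rewrite andb_idr// => /shuffle_perm_first.
  by move=> /(_ isT); rewrite orbb.
(* With [v] empty the second block would start at [n.+1], which is not a position, so every shuffle
   belongs to the left half. *)
- rewrite [X in _ = _ + X]big_nil addr0 -(@sum_perm_left_step n)//;
    last by case: nE.
  apply: eq_bigl => s; rewrite andb_idr// => /shuffle_perm_first.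
  have -> : (size u).+1 = n.+1 by rewrite nE addn0.
  move=> /(_ (leqnn _)) /orP[//|/forallP/(_ ord0)/=].
  by rewrite eqn_leq [(n.+1 <= _)%N]leqNgt ltn_ord andbF.
- rewrite -(@sum_perm_left_step n)//; last by case: nE.
  rewrite -(@sum_perm_right_step n)//; last by rewrite addnS in nE; case: nE.
  rewrite (bigID (fun s => first_from s 0)) /=; congr (_ + _).
  apply: eq_bigl => s; case shs: (shuffle_perm _ s) => //=.
  have kn : (size (a :: u) <= n.+1)%N by rewrite nE leq_addr.
  have := shuffle_perm_first kn shs.
  case s0 : (first_from s 0) => /=; last by move=> ->.
  by move=> _; apply/esym/negbTE/(first_only _ _ 0).
Qed.
End Words.
End PermutationShuffles.

(** * The operations on basis words as sums over half-shuffles *)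

Section ChenWords.
Variables (K : fieldType) (R : realType) (Omega : choiceType).
Variable G : Omega -> R -> R.
Implicit Types u v : seq Omega.

Lemma shuffle_wordE x0 u v (s : 'S_(size u + size v)) :
  shuffle_word s = perm_word x0 (u ++ v) s.
Proof. by apply: eq_map => i; rewrite (tnth_nth x0). Qed.

(** The unit rules agree with the degenerate half-shuffles: none if [u] is empty, only [u] itself if
    just [v] is. *)
Lemma chen_prec_wordE u v :
  chen_prec_word K G u v = \sum_(w <- left_shuffles u v) chen K G w.
Proof.
case: u v => [|a u] [|b v]; rewrite ?big_nil//.
  by rewrite sum_left_shuffles shuffles0r big_seq1.
rewrite -(sum_perm_left_step a _ (@sum_perm_shuffles _ _ a _) (erefl _)).
by apply: eq_big => s; rewrite ?is_shuffleE// => _;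
  rewrite (@shuffle_wordE a _ _ s).
Qed.

Lemma chen_succ_wordE u v :
  chen_succ_word K G u v = \sum_(w <- right_shuffles u v) chen K G w.
Proof.
case: u v => [|a u] [|b v]; rewrite ?big_nil//.
  by rewrite sum_right_shuffles shuffles0l big_seq1.
transitivity (\sum_(s : 'S_(size (a :: u) + size (b :: v)) |
    shuffle_perm (size (a :: u)) s && first_from s (size (a :: u)))
  chen K G (perm_word a ((a :: u) ++ b :: v) s)).
  by apply: eq_big => s; rewrite ?is_shuffleE// => _;
    rewrite (@shuffle_wordE a _ _ s).
(* The index of the symmetric group is a successor only up to [addnS], so it is generalized before
   being replaced. *)
have := addnS (size (a :: u)) (size v).
rewrite -[(size v).+1]/(size (b :: v)); move: (_ + size (b :: v))%N => n ->.
exact: (sum_perm_right_step _ _ (@sum_perm_shuffles _ _ _ _)).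
Qed.
End ChenWords.

(** * Coordinates on the basis [chen w] and bilinear extension *)

Section ChenDendriform.
Variables (K : fieldType) (R : realType) (Omega : choiceType).
Variable G : Omega -> R -> R.
Local Notation V := (@chen_space K R Omega G).
Local Notation word := (seq Omega).
Local Notation chen := (@chen K R Omega G).
Local Notation one := (@chen_one K R Omega G).
Implicit Types (x y z : V) (u v w : word) (op : word -> word -> V).

(** The word comes first so that each coefficient can be declared a linear form. *)
Definition coef_at w x : K := chen_coef x w.
Let coef_at_linear w : scalar (coef_at w).
Proof. exact: chen_coef_linear. Qed.
HB.instance Definition _ w :=
  GRing.isLinear.Build K V K *%R (coef_at w) (coef_at_linear w).

Lemma coef_at_chen w u : coef_at w (chen u) = (w == u)%:R.
Proof. exact: chen_coef_chen. Qed.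

(** [U] only has to contain the support, so that several elements can share one list. *)
Definition supported_on (U : seq word) x :=
  forall w, w \notin U -> coef_at w x = 0.

Lemma chen_supp x : exists2 U : seq word, uniq U & supported_on U x.
Proof.
have /finite_seqP[U UE] := chen_coef_finite x.
exists (undup U) => [|w]; first exact: undup_uniq.
rewrite mem_undup => wU; apply/eqP; apply: contraNT wU => xw.
by have : [set` U] w by rewrite -UE.
Qed.

Lemma chen_sum_coef (U : seq word) x : uniq U -> supported_on U x ->
  x = \sum_(u <- U) coef_at u x *: chen u.
Proof.
move=> uU xU; apply: chen_coef_inj => w.
rewrite -!/(coef_at w _) linear_sum.
under eq_bigr do rewrite linearZ /= coef_at_chen.
have [wU|wU] := boolP (w \in U).
  rewrite (bigD1_seq w)//= eqxx mulr1 big1 ?addr0// => i iw.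
  by rewrite eq_sym (negPf iw) mulr0.
rewrite xU// big_seq big1// => i iU.
by rewrite (_ : w == i = false) ?mulr0//; apply: contraNF wU => /eqP ->.
Qed.

(** The total counterpart of [bilinear_ext], without its test on the coefficients of the empty word;
    it is bilinear on the whole space. *)
Definition chen_bilinear op x y : V :=
  \sum_(p \in [set: word * word])
    (chen_coef x p.1 * chen_coef y p.2) *: op p.1 p.2.

(** The freedom in [U] and [W] allows the sums for [x1], [x2] and [a *: x1 + x2] to be compared term
    by term. *)
Lemma chen_bilinearE op (U W : seq word) x y :
    uniq U -> supported_on U x -> uniq W -> supported_on W y ->
  chen_bilinear op x y =
  \sum_(u <- U) \sum_(w <- W) (coef_at u x * coef_at w y) *: op u w.
Proof.
move=> uU xU uW yW; rewrite /chen_bilinear.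
rewrite (fsbigE [seq (u, w) | u <- U, w <- W])//=.
- under eq_bigl do rewrite classical_sets.in_setT.
  by rewrite big_allpairs_dep.
- by apply: allpairs_uniq => // -[? ?] [? ?].
- move=> [u w] _ /= uw; have [uU'|uU'] := boolP (u \in U); last first.
    by rewrite -/(coef_at u x) xU// mul0r scale0r.
  have wW : w \notin W.
    by apply: contraNN uw => wW; apply/allpairsP; exists (u, w).
  by rewrite -/(coef_at w y) yW// mulr0 scale0r.
Qed.

Lemma chen_bilinear_chen op u v : chen_bilinear op (chen u) (chen v) = op u v.
Proof.
have sup w : supported_on [:: w] (chen w).
  by move=> t; rewrite inE coef_at_chen => /negPf ->.
rewrite (chen_bilinearE _ _ (sup u) _ (sup v))// !big_seq1.
by rewrite !coef_at_chen !eqxx mulr1 scale1r.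
Qed.

Lemma chen_supp2 x y : exists U : seq word,
  [/\ uniq U, supported_on U x & supported_on U y].
Proof.
have [[U1 uU1 xU1] [U2 uU2 yU2]] := (chen_supp x, chen_supp y).
exists (undup (U1 ++ U2)); split; first exact: undup_uniq.
  by move=> w; rewrite mem_undup mem_cat negb_or => /andP[/xU1].
by move=> w; rewrite mem_undup mem_cat negb_or => /andP[_ /yU2].
Qed.

Lemma supported_onP (U : seq word) a x y :
  supported_on U x -> supported_on U y -> supported_on U (a *: x + y).
Proof. by move=> xU yU w wU; rewrite linearP /= xU// yU// mulr0 addr0. Qed.

Lemma chen_bilinearPl op a x1 x2 y :
  chen_bilinear op (a *: x1 + x2) y =
  a *: chen_bilinear op x1 y + chen_bilinear op x2 y.
Proof.
have [[U [uU U1 U2]] [W uW yW]] := (chen_supp2 x1 x2, chen_supp y).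
rewrite (chen_bilinearE _ uU U1 uW yW) (chen_bilinearE _ uU U2 uW yW).
rewrite (chen_bilinearE _ uU (supported_onP a U1 U2) uW yW).
rewrite scaler_sumr -big_split; apply: eq_bigr => u _ /=.
rewrite scaler_sumr -big_split; apply: eq_bigr => w _ /=.
by rewrite linearP mulrDl scalerDl scalerA mulrA.
Qed.

Lemma chen_bilinearPr op a x y1 y2 :
  chen_bilinear op x (a *: y1 + y2) =
  a *: chen_bilinear op x y1 + chen_bilinear op x y2.
Proof.
have [[U [uU U1 U2]] [W uW yW]] := (chen_supp2 y1 y2, chen_supp x).
rewrite (chen_bilinearE _ uW yW uU U1) (chen_bilinearE _ uW yW uU U2).
rewrite (chen_bilinearE _ uW yW uU (supported_onP a U1 U2)).
rewrite scaler_sumr -big_split; apply: eq_bigr => u _ /=.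
rewrite scaler_sumr -big_split; apply: eq_bigr => w _ /=.
by rewrite linearP mulrDr scalerDl scalerA mulrCA.
Qed.

HB.instance Definition _ op x := GRing.isLinear.Build K V V *:%R
  (chen_bilinear op x) (fun a => chen_bilinearPr op a x).

Definition chen_bilinear_swap op y x := chen_bilinear op x y.
HB.instance Definition _ op y := GRing.isLinear.Build K V V *:%R
  (chen_bilinear_swap op y) (fun a x1 x2 => chen_bilinearPl op a x1 x2 y).

Lemma chen_bilinearD op1 op2 x y :
  chen_bilinear op1 x y + chen_bilinear op2 x y =
  chen_bilinear (fun u v => op1 u v + op2 u v) x y.
Proof.
have [[U uU xU] [W uW yW]] := (chen_supp x, chen_supp y).
rewrite !(chen_bilinearE _ uU xU uW yW) -big_split; apply: eq_bigr => u _ /=.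
by rewrite -big_split; apply: eq_bigr => w _ /=; rewrite scalerDr.
Qed.

(** * The ideal without unit component and its dendriform identities *)

Definition aug_ideal : {pred V} := fun x => coef_at [::] x == 0.

Let aug_ideal_submod : submod_closed aug_ideal.
Proof.
split=> [|a x y]; rewrite !unfold_in; first by rewrite linear0.
by move=> /eqP x0 /eqP y0; rewrite linearP /= x0 y0 mulr0 addr0.
Qed.
HB.instance Definition _ :=
  GRing.isSubmodClosed.Build K V aug_ideal aug_ideal_submod.

Definition aug_ideal_of := {x : V | aug_ideal x}.
HB.instance Definition _ := Choice.on aug_ideal_of.
HB.instance Definition _ := SubType.on aug_ideal_of.
HB.instance Definition _ := [SubChoice_isSubLmodule of aug_ideal_of by <:].

Lemma chen_cons_aug_ideal a w : chen (a :: w) \in aug_ideal.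
Proof. by rewrite unfold_in coef_at_chen. Qed.

Lemma chen_bilinear_aug_ideal op x y :
  (forall u v, op u v \in aug_ideal) -> chen_bilinear op x y \in aug_ideal.
Proof.
move=> opI; have [[U uU xU] [W uW yW]] := (chen_supp x, chen_supp y).
rewrite (chen_bilinearE _ uU xU uW yW).
by apply: rpred_sum => u _; apply: rpred_sum => v _; exact: rpredZ.
Qed.

(** In the expansion of [x] on the basis, the term of the empty word has coefficient zero, so
    nonempty words suffice. *)
Lemma aug_ideal_ind (P : V -> Prop) :
  (forall a x y, P x -> P y -> P (a *: x + y)) -> P 0 ->
  (forall a u, P (chen (a :: u))) -> forall x, x \in aug_ideal -> P x.
Proof.
move=> PD P0 Pchen x /eqP x0; have [U uU xU] := chen_supp x.
rewrite (chen_sum_coef uU xU) {xU uU}.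
elim: U => [|u U IHU]; first by rewrite big_nil.
rewrite big_cons; case: u => [|a u]; first by rewrite x0 scale0r add0r.
exact: PD.
Qed.

(** Both sides are trilinear, which reduces the identity to nonempty words. Four independent
    operations let one lemma serve all three dendriform identities. *)
Lemma chen_bilinear_assoc op1 op2 op3 op4 :
  (forall a u b v c w,
     chen_bilinear op1 (op2 (a :: u) (b :: v)) (chen (c :: w)) =
     chen_bilinear op3 (chen (a :: u)) (op4 (b :: v) (c :: w))) ->
  {in aug_ideal & &, forall x y z,
     chen_bilinear op1 (chen_bilinear op2 x y) z =
     chen_bilinear op3 x (chen_bilinear op4 y z)}.
Proof.
have b0l op y : chen_bilinear op 0 y = 0.
  exact: (linear0 (chen_bilinear_swap op y)).
move=> opA x y z xI yI zI.
move: x xI; apply: aug_ideal_ind => [k x1 x2 E1 E2||a u].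
- by rewrite !chen_bilinearPl E1 E2.
- by rewrite !b0l.
move: y yI; apply: aug_ideal_ind => [k y1 y2 E1 E2||b v].
- by rewrite !(chen_bilinearPl, chen_bilinearPr) E1 E2.
- by rewrite linear0 !b0l linear0.
move: z zI; apply: aug_ideal_ind => [k z1 z2 E1 E2||c w].
- by rewrite !chen_bilinearPr E1 E2.
- by rewrite !linear0.
by rewrite !chen_bilinear_chen.
Qed.

Lemma chen_bilinear_suml op (s : seq word) v :
  chen_bilinear op (\sum_(u <- s) chen u) (chen v) = \sum_(u <- s) op u v.
Proof.
rewrite -[LHS]/(chen_bilinear_swap op (chen v) _) linear_sum.
by apply: eq_bigr => u _; exact: chen_bilinear_chen.
Qed.

Lemma chen_bilinear_sumr op u (s : seq word) :
  chen_bilinear op (chen u) (\sum_(v <- s) chen v) = \sum_(v <- s) op u v.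
Proof.
by rewrite linear_sum; apply: eq_bigr => v _; exact: chen_bilinear_chen.
Qed.

Local Notation precw := (@chen_prec_word K R Omega G).
Local Notation succw := (@chen_succ_word K R Omega G).

Lemma chen_prec_word_aug_ideal u v : precw u v \in aug_ideal.
Proof.
rewrite chen_prec_wordE; case: u => [|a u]; first by rewrite big_nil rpred0.
by rewrite sum_left_shuffles rpred_sum// => w _; exact: chen_cons_aug_ideal.
Qed.

Lemma chen_succ_word_aug_ideal u v : succw u v \in aug_ideal.
Proof.
rewrite chen_succ_wordE; case: v => [|a v]; first by rewrite big_nil rpred0.
by rewrite sum_right_shuffles rpred_sum// => w _; exact: chen_cons_aug_ideal.
Qed.

Definition aug_prec_op (x y : aug_ideal_of) : aug_ideal_of :=
  exist _ (chen_bilinear precw (val x) (val y))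
    (chen_bilinear_aug_ideal _ _ chen_prec_word_aug_ideal).

Definition aug_succ_op (x y : aug_ideal_of) : aug_ideal_of :=
  exist _ (chen_bilinear succw (val x) (val y))
    (chen_bilinear_aug_ideal _ _ chen_succ_word_aug_ideal).

Lemma chen_star_wordE u v : (0 < size u + size v)%N ->
  precw u v + succw u v = \sum_(w <- shuffles u v) chen w.
Proof. by move=> uv; rewrite chen_prec_wordE chen_succ_wordE -sum_shuffles. Qed.

Lemma aug_dendriform : dendriform aug_prec_op aug_succ_op.
Proof.
split.
- split=> [x a y1 y2|y a x1 x2]; apply: val_inj.
    exact: chen_bilinearPr.
  exact: chen_bilinearPl.
- split=> [x a y1 y2|y a x1 x2]; apply: val_inj.
    exact: chen_bilinearPr.
  exact: chen_bilinearPl.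
move=> [x xI] [y yI] [z zI]; split; apply: val_inj => /=.
(* [chen_bilinearD] turns the star product into the extension of a single word operation, as the
   lemma requires. *)
- rewrite chen_bilinearD; apply: chen_bilinear_assoc xI yI zI => a u b v c w.
  rewrite chen_star_wordE// chen_bilinear_sumr.
  rewrite chen_prec_wordE chen_bilinear_suml.
  under eq_bigr do rewrite chen_prec_wordE.
  under [RHS]eq_bigr do rewrite chen_prec_wordE.
  by apply: left_left_shuffles; exact: shufflesA.
- apply: chen_bilinear_assoc xI yI zI => a u b v c w.
  rewrite chen_prec_wordE chen_succ_wordE chen_bilinear_suml chen_bilinear_sumr.
  under eq_bigr do rewrite chen_prec_wordE.
  under [RHS]eq_bigr do rewrite chen_succ_wordE.
  by apply: right_left_shuffles; exact: shufflesA.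
- rewrite chen_bilinearD; apply: chen_bilinear_assoc xI yI zI => a u b v c w.
  rewrite chen_star_wordE// chen_bilinear_suml.
  rewrite chen_succ_wordE chen_bilinear_sumr.
  under eq_bigr do rewrite chen_succ_wordE.
  under [RHS]eq_bigr do rewrite chen_succ_wordE.
  by apply: right_right_shuffles; exact: shufflesA.
Qed.

(** * Splitting off the unit, and products with the unit *)

Lemma aug_part_subproof x : aug_ideal (x - coef_at [::] x *: one).
Proof.
by rewrite /aug_ideal linearB linearZ /= coef_at_chen eqxx mulr1 subrr.
Qed.

Definition aug_part x : aug_ideal_of := exist aug_ideal _ (aug_part_subproof x).

Definition aug_split x : aug aug_ideal_of := (aug_part x, coef_at [::] x).

Lemma aug_split_linear : linear aug_split.
Proof.
move=> a x y; congr pair; last exact: linearP.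
apply: val_inj; rewrite /= linearP scalerDl opprD addrACA; congr (_ + _).
by rewrite scalerBr scalerA.
Qed.
HB.instance Definition _ := GRing.isLinear.Build K V (aug aug_ideal_of) *:%R
  aug_split aug_split_linear.

Lemma aug_split_bij : bijective aug_split.
Proof.
exists (fun p : aug aug_ideal_of => val p.1 + p.2 *: one) => [x|[[x xI] l]].
  by rewrite /= subrK.
have c0 : coef_at [::] (x + l *: one) = l.
  by rewrite linearD linearZ /= coef_at_chen eqxx mulr1 (eqP xI) add0r.
by congr pair => //; apply: val_inj; rewrite /= c0 addrK.
Qed.

(** Writing each argument as a multiple of [one] plus an element of the ideal gives four products;
    the product of the two units vanishes by hypothesis. *)
Lemma chen_bilinear_split op x y : op [::] [::] = 0 ->
  chen_bilinear op x y =
  chen_bilinear op (val (aug_split x).1) (val (aug_split y).1) +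
  coef_at [::] y *: chen_bilinear op (val (aug_split x).1) one +
  coef_at [::] x *: chen_bilinear op one (val (aug_split y).1).
Proof.
move=> op0; have sE t : t = coef_at [::] t *: one + val (aug_split t).1.
  by rewrite /= addrC subrK.
rewrite {1}(sE x) {1}(sE y) chen_bilinearPl !chen_bilinearPr.
rewrite chen_bilinear_chen op0 scaler0 add0r addrC; congr (_ + _).
exact: addrC.
Qed.

(** The first of four unit rules: [chen_bilinear_oner] and [chen_bilinear_one0l] serve for the left
    operation, [chen_bilinear_one0r] and [chen_bilinear_onel] for the right one. *)
Lemma chen_bilinear_oner op : (forall a u, op (a :: u) [::] = chen (a :: u)) ->
  {in aug_ideal, forall x, chen_bilinear op x one = x}.
Proof.
move=> op1; apply: aug_ideal_ind => [k x1 x2 E1 E2||a u].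
- by rewrite chen_bilinearPl E1 E2.
- exact: (linear0 (chen_bilinear_swap op one)).
- by rewrite chen_bilinear_chen op1.
Qed.

Lemma chen_bilinear_onel op : (forall a u, op [::] (a :: u) = chen (a :: u)) ->
  {in aug_ideal, forall x, chen_bilinear op one x = x}.
Proof.
move=> op1; apply: aug_ideal_ind => [k x1 x2 E1 E2||a u].
- by rewrite chen_bilinearPr E1 E2.
- exact: linear0.
- by rewrite chen_bilinear_chen op1.
Qed.

Lemma chen_bilinear_one0r op : (forall a u, op (a :: u) [::] = 0) ->
  {in aug_ideal, forall x, chen_bilinear op x one = 0}.
Proof.
move=> op1; apply: aug_ideal_ind => [k x1 x2 E1 E2||a u].
- by rewrite chen_bilinearPl E1 E2 scaler0 addr0.
- exact: (linear0 (chen_bilinear_swap op one)).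
- by rewrite chen_bilinear_chen op1.
Qed.

Lemma chen_bilinear_one0l op : (forall a u, op [::] (a :: u) = 0) ->
  {in aug_ideal, forall x, chen_bilinear op one x = 0}.
Proof.
move=> op1; apply: aug_ideal_ind => [k x1 x2 E1 E2||a u].
- by rewrite chen_bilinearPr E1 E2 scaler0 addr0.
- exact: linear0.
- by rewrite chen_bilinear_chen op1.
Qed.
End ChenDendriform.

Theorem proposition5p6 (K : fieldType) (R : realType) (Omega : choiceType)
    (G : Omega -> R -> R) :
  augmented_dendriform (@chen_one K R Omega G)
    (@chen_prec K R Omega G) (@chen_succ K R Omega G).
Proof.
exists (aug_ideal_of K G), (@aug_prec_op K R Omega G).
exists (@aug_succ_op K R Omega G).
exists (@aug_split K R Omega G); split.
- exact: aug_dendriform.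
- exact: aug_split_bij.
- have c1 : coef_at [::] (chen_one K G) = 1 by rewrite coef_at_chen eqxx.
  by congr pair => //; apply: val_inj; rewrite /= c1 scale1r subrr.
- move=> x y; rewrite /chen_prec /bilinear_ext /aug_prec /=.
  (* Both sides test the same product of coefficients of the empty word, so they are undefined
     together. *)
  case: ifP => //= xy0; congr Some.
  set b := (X in aug_split X).
  have bE : b = chen_bilinear (chen_prec_word K G) x y by [].
  (* A product has no unit component, which matches the zero second component in [aug_prec]. *)
  have bI : coef_at [::] b = 0.
    apply/eqP; apply: chen_bilinear_aug_ideal.
    exact: chen_prec_word_aug_ideal.
  congr pair => //; apply: val_inj; rewrite /= bI scale0r subr0 bE.
  rewrite chen_bilinear_split// chen_bilinear_oner ?chen_bilinear_one0l;
    [by rewrite scaler0 addr0|by []|exact: valP|by []|exact: valP].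
- move=> x y; rewrite /chen_succ /bilinear_ext /aug_succ /=.
  case: ifP => //= xy0; congr Some.
  set b := (X in aug_split X).
  have bE : b = chen_bilinear (chen_succ_word K G) x y by [].
  have bI : coef_at [::] b = 0.
    apply/eqP; apply: chen_bilinear_aug_ideal.
    exact: chen_succ_word_aug_ideal.
  congr pair => //; apply: val_inj; rewrite /= bI scale0r subr0 bE.
  rewrite chen_bilinear_split// chen_bilinear_one0r ?chen_bilinear_onel
    ?scaler0 ?addr0//; exact: valP.
Qed.
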